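(* As the prime power $q\to\infty$, with probability tending to $1$, $$\alpha(\mathbb{F}_q^2,p)=\begin{cases}\Theta(pq^2), & q^{-2+o(1)}\le p\le q^{-3/2-o(1)};\\ q^{1/2+o(1)}, & q^{-3/2-o(1)}\le p\le q^{-1/2+o(1)};\\ (1\pm o(1))pq, & q^{-1/2+o(1)}\le p\le 1.\end{cases}$$ Here the $q^{o(1)}$ factors denote polylogarithmic factors in $q$.
   Context: For $p\in[0,1]$, the $p$-random set $\mathbf{S}_p\subset\mathbb{F}_q^2$ is obtained by including each point of $\mathbb{F}_q^2$ independently with probability $p$. A set in $\mathbb{F}_q^2$ is collinear-triple-free if no three of its points lie on a common line. $\alpha(\mathbb{F}_q^2,p)$ denotes the maximum size of a collinear-triple-free subset of $\mathbf{S}_p$ (a random variable). $p=p(q)$ may depend on $q$. *)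

(* Defs.v *)
From HB Require Import structures.
From mathcomp Require Import all_boot all_order all_algebra.
From mathcomp Require Import all_classical all_reals all_analysis.

Set Implicit Arguments.
Unset Strict Implicit.
Unset Printing Implicit Defensive.

Import Order.TTheory GRing.Theory Num.Theory.
Import numFieldNormedType.Exports.

Local Open Scope ring_scope.

Definition prime_power (q : nat) : Prop :=
  exists l k : nat, [/\ prime l, (0 < k)%N & q = (l ^ k)%N].

Section AffinePlane.
Variable F : finFieldType.
Local Notation plane := 'rV[F]_2.

Definition line (a v : plane) : {set plane} := [set a + t *: v | t : F].

Definition collinear (T : {set plane}) : bool :=
  [exists a, exists v, (v != 0) && (T \subset line a v)].

Definition collinear_triple_free (A : {set plane}) : bool :=
  [forall T : {set plane}, (T \subset A) && (#|T| == 3%N) ==> ~~ collinear T].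

Definition alpha (S : {set plane}) : nat :=
  \max_(A : {set plane} | (A \subset S) && collinear_triple_free A) #|A|.

End AffinePlane.

(* Probability that the p-random subset of T belongs to E: each point is kept
   independently with probability p, so a given S has mass the product below. *)
Definition prob_random_set (R : realType) (T : finType) (p : R)
    (E : pred {set T}) : R :=
  \sum_(S : {set T} | E S) \prod_(x : T) (if x \in S then p else 1 - p).

(* The probability of E F tends to 1 as #|F| tends to infinity, where the points
   of F^2 are kept with probability p #|F|. Finite fields have prime power order,
   so the condition is void at every other q. *)
Definition with_high_probability (R : realType) (p : nat -> R)
    (E : forall F : finFieldType, pred {set 'rV[F]_2}) : Prop :=
  forall eps : R, 0 < eps ->
    \forall q \near \oo%classic, forall F : finFieldType, #|F| = q ->
      1 - eps <= prob_random_set (p q) (E F).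

(* q^a (log q)^b; polylogarithmic factors have the form (log q)^b, b constant *)
Definition qpolylog (R : realType) (a b : R) (q : nat) : R :=
  (q%:R `^ a) * (ln (q%:R : R) `^ b).

Definition eventually_between (R : realType) (lo p hi : nat -> R) : Prop :=
  \forall q \near \oo%classic, prime_power q -> lo q <= p q <= hi q.

(* Main.v *)
Require Import Defs.
From HB Require Import structures.
From mathcomp Require Import all_boot all_order all_algebra.
From mathcomp Require Import all_classical all_reals all_analysis.
From mathcomp Require Import finfield.
From mathcomp Require Import ring lra.

Set Implicit Arguments.
Unset Strict Implicit.
Unset Printing Implicit Defensive.

Import Order.TTheory GRing.Theory Num.Theory.
Import numFieldNormedType.Exports.

Local Open Scope ring_scope.

(** Call a collinear-triple-free set an arc. For [p] below [q^(-3/2)] there are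
    far fewer collinear triples in the random set than points, so deleting a
    point from each of them leaves a positive proportion of the set; being
    monotone in [p], this also bounds [alpha] from below in the middle range.
    For large [p] the lower bound comes from the intersection with a parabola.
    The upper bounds come from containers. Fix about [sqrt q] points [F0] of an
    arc [I] and join two points of the plane when they are collinear with a
    third point of [F0]; then [I] is independent. A set of [(1 + delta) q]
    points has an excess over the [q + 1] lines through each point of [F0], and
    each edge comes from at most two points of [F0], so this graph is dense on
    such a set. The Kleitman-Winston algorithm then places [I] in one of
    [exp(sqrt q (log q)^O(1))] sets of size [(1 + o(1)) q], and Chernoff's
    bound with a union over these sets concludes. *)

(** * Random subsets *)

Section RandomSet.
Variables (R : realType) (T : finType).
Implicit Types (p : R) (S D : {set T}) (E : pred {set T}).

Definition mass p S : R := \prod_x (if x \in S then p else 1 - p).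

Lemma sum_prod_set (a b : T -> R) :
  \sum_(S : {set T}) \prod_x (if x \in S then a x else b x) =
  \prod_x (a x + b x).
Proof. by rewrite bigA_distr. Qed.

Lemma mass_ge0 p S : 0 <= p <= 1 -> 0 <= mass p S.
Proof. by move=> hp; apply: prodr_ge0 => x _; case: ifP => _; lra. Qed.

Lemma sum_mass p : \sum_S mass p S = 1.
Proof. by rewrite sum_prod_set big1 // => x _; ring. Qed.

Lemma probC p E :
  prob_random_set p E = 1 - prob_random_set p (fun S => ~~ E S).
Proof. by rewrite -(sum_mass p) (bigID E) /= addrK. Qed.

Lemma prob_mono p E E' : 0 <= p <= 1 -> (forall S, E S -> E' S) ->
  prob_random_set p E <= prob_random_set p E'.
Proof.
move=> hp EE'; rewrite /prob_random_set [leRHS](bigID E) /=.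
have eqE S : E' S && E S = E S by case ES: (E S); rewrite ?andbF // (EE' _ ES).
rewrite (eq_bigl _ _ eqE) lerDl.
by apply: sumr_ge0 => S _; apply: mass_ge0.
Qed.

Lemma probU_le p E E' : 0 <= p <= 1 ->
  prob_random_set p (fun S => E S || E' S) <=
  prob_random_set p E + prob_random_set p E'.
Proof.
move=> hp; rewrite /prob_random_set (bigID E) /=.
rewrite (eq_bigl E) => [|S]; last by case: (E S); rewrite ?andbT ?andbF.
rewrite lerD2l; rewrite (eq_bigl (fun S => E' S && ~~ E S)) => [|S].
  by rewrite [leRHS](bigID E) /= lerDr; apply: sumr_ge0 => S _; apply: mass_ge0.
by case: (E S); rewrite /= ?andbF.
Qed.

Lemma prob_union_le p (I : finType) (J : {set I}) (E : I -> pred {set T}) b :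
  0 <= p <= 1 -> (forall i, i \in J -> prob_random_set p (E i) <= b) ->
  prob_random_set p (fun S => [exists i in J, E i S]) <= #|J|%:R * b.
Proof.
move=> hp hE; apply: (@le_trans _ _ (\sum_(i in J) prob_random_set p (E i))).
  rewrite /prob_random_set (exchange_big_dep xpredT) //= [leLHS]big_mkcond /=.
  apply: ler_sum => S _; case: ifP => [/exists_inP[i iJ iE]|_]; last first.
    by apply: sumr_ge0 => i _; apply: mass_ge0.
  rewrite (bigD1 i) ?iJ //= lerDl; apply: sumr_ge0 => k _; exact: mass_ge0.
rewrite mulr_natl -sumr_const; exact: ler_sum.
Qed.

Lemma markov_random_set p (h : {set T} -> R) E c :
  0 <= p <= 1 -> (forall S, 0 <= h S) -> (forall S, E S -> c <= h S) ->
  c * prob_random_set p E <= \sum_S mass p S * h S.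
Proof.
move=> hp h0 hE; rewrite /prob_random_set mulr_sumr [leLHS]big_mkcond /=.
apply: ler_sum => S _; case: ifP => [/hE hS|_]; last first.
  by rewrite mulr_ge0 // mass_ge0.
by rewrite mulrC ler_wpM2l // mass_ge0.
Qed.

Lemma prob_superset p D :
  prob_random_set p (fun S => D \subset S) = p ^+ #|D|.
Proof.
transitivity (\sum_(S : {set T}) \prod_x
    (if x \in S then p else if x \in D then 0 else 1 - p)).
  rewrite /prob_random_set big_mkcond /=; apply: eq_bigr => S _.
  case: ifP => [/fintype.subsetP DS|/fintype.subsetPn[x xD xS]].
    apply: eq_bigr => x _; case: ifP => // xS.
    by case: ifP => // /DS; rewrite xS.
  by rewrite (bigD1 x) //= (negPf xS) xD mul0r.
rewrite sum_prod_set -prodr_const [RHS]big_mkcond /=.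
by apply: eq_bigr => x _; case: ifP => _; ring.
Qed.

Lemma exp_moment_card p (u : R) D :
  \sum_S mass p S * u ^+ #|S :&: D| = (1 + p * (u - 1)) ^+ #|D|.
Proof.
transitivity (\sum_(S : {set T}) \prod_x
    (if x \in S then (if x \in D then p * u else p) else 1 - p)).
  apply: eq_bigr => S _; rewrite -prodr_const [X in _ * X]big_mkcond /=.
  rewrite -big_split /=; apply: eq_bigr => x _; rewrite inE.
  by case: ifP => _ /=; rewrite ?mulr1 //; case: ifP => _; rewrite ?mulr1.
rewrite sum_prod_set -prodr_const [RHS]big_mkcond /=.
by apply: eq_bigr => x _; case: ifP => _; ring.
Qed.

(** It suffices to bound [expR (- x)] below by a factor whose product with [1 + x + x ^+ 2] is at
    least 1. This factor is [1 - x] for [x <= 0] and [(1 - x / 2) ^+ 2] for [0 < x <= 1 / 4]. *)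
Lemma expR_quadratic_bound (x : R) : x <= 1 / 4 -> expR x <= 1 + x + x ^+ 2.
Proof.
move=> hx; have hq : 0 < 1 + x + x ^+ 2 by nra.
have hN (y : R) : expR y * expR (- y) = 1 by rewrite expRN mulfV // gt_eqF ?expR_gt0.
have := expR_gt0 x; have := expR_gt0 (- x); have := hN x.
have [x0|x0] := leP x 0.
  have := expR_ge1Dx (- x); move: (expR x) (expR (- x)) => a b; nra.
have hh : expR (- x) = expR (- (x / 2)) ^+ 2.
  by rewrite -expRM_natl; congr expR; field.
have := expR_ge1Dx (- (x / 2)); rewrite hh.
move: (expR x) (expR (- (x / 2))) => a b hb hab hb0 ha0.
have hb2 : (1 - x / 2) ^+ 2 <= b ^+ 2 by nra.
have h1 : a * (1 - x / 2) ^+ 2 <= 1.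
  by apply: (@le_trans _ _ (a * b ^+ 2)); rewrite ?ler_pM2l // hab.
have h2 : 1 <= (1 - x / 2) ^+ 2 * (1 + x + x ^+ 2).
  have -> : (1 - x / 2) ^+ 2 * (1 + x + x ^+ 2) =
     1 + x ^+ 2 / 4 * (1 - 3 * x + x ^+ 2) by field.
  by rewrite lerDl mulr_ge0 //; nra.
have h3 : 0 < (1 - x / 2) ^+ 2 by nra.
by rewrite -(ler_pM2r h3); apply: le_trans h1 _; rewrite mulrC.
Qed.

(* A negative [lam] gives the lower tail. *)
Lemma chernoff_card p D (lam m : R) : 0 <= p <= 1 -> lam <= 1 / 4 ->
  prob_random_set p (fun S => lam * m <= lam * #|S :&: D|%:R) <=
  expR (p * #|D|%:R * (lam + lam ^+ 2) - lam * m).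
Proof.
move=> hp hl; rewrite expRD expRN.
rewrite ler_pdivlMr ?expR_gt0 // mulrC.
apply: le_trans
  (@markov_random_set p (fun S => expR lam ^+ #|S :&: D|) _ _ hp _ _) _.
- by move=> S; rewrite exprn_ge0 // expR_ge0.
- by move=> S hS; rewrite -expRM_natl ler_expR (mulrC _%:R).
rewrite exp_moment_card -mulrA mulrCA expRM_natl; apply: lerXn2r; rewrite ?nnegrE ?expR_ge0 //.
  by have := expR_gt0 lam; nra.
apply: le_trans (expR_ge1Dx _); rewrite lerD2l.
by rewrite ler_wpM2l; have := expR_quadratic_bound hl; lra.
Qed.

(** Coupling: keeping each point of the [p']-random set independently with probability [p / p']
    gives a [p]-random subset of it. *)
Lemma prob_increasing p p' E : 0 <= p -> p <= p' -> p' <= 1 ->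
  (forall S S' : {set T}, S \subset S' -> E S -> E S') ->
  prob_random_set p E <= prob_random_set p' E.
Proof.
move=> p0 pp' p'1 Emono.
have [p'0|p'0] := eqVneq p' 0.
  by have -> : p = p' by lra.
have p'_gt0 : 0 < p' by lra.
pose r := p / p'.
have hr : 0 <= r <= 1.
  by rewrite /r ler_pdivrMr // mul1r pp' divr_ge0 // ltW.
(* [K S' S] is the probability that thinning [S'] leaves [S]; it vanishes unless [S] is a subset of
   [S']. *)
pose K S' S : R := \prod_x (if x \in S' then (if x \in S then r else 1 - r)
                            else (if x \in S then 0 else 1)).
have K_ge0 S' S : 0 <= K S' S.
  by apply: prodr_ge0 => x _; do 2! case: ifP => _ //; lra.
have sumK S' : \sum_S K S' S = 1.
  transitivity (\sum_(S : {set T}) \prod_x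
      (if x \in S then (if x \in S' then r else 0)
       else (if x \in S' then 1 - r else 1))).
    by apply: eq_bigr => S _; apply: eq_bigr => x _; do 2! case: ifP.
  rewrite sum_prod_set big1 // => x _; case: ifP => _; ring.
have K0 S' S : ~~ (S \subset S') -> K S' S = 0.
  by case/fintype.subsetPn=> x xS xS'; rewrite /K (bigD1 x) //= (negPf xS') xS mul0r.
have massK S : mass p S = \sum_S' mass p' S' * K S' S.
  transitivity (\sum_(S' : {set T}) \prod_x
      (if x \in S' then p' * (if x \in S then r else 1 - r)
       else (1 - p') * (if x \in S then 0 else 1))).
    rewrite sum_prod_set; apply: eq_bigr => x _; rewrite /r.
    by case: ifP => _; field.
  apply: eq_bigr => S' _; rewrite /mass /K -big_split /=.
  by apply: eq_bigr => x _; case: ifP.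
rewrite /prob_random_set (eq_bigr _ (fun S _ => massK S)) exchange_big /=.
rewrite [leRHS]big_mkcond /=; apply: ler_sum => S' _.
rewrite -mulr_sumr; have m0 : 0 <= mass p' S' by apply: mass_ge0; lra.
case: ifP => ES'.
  rewrite ler_piMr // -(sumK S') [leRHS](bigID E) /= lerDl.
  exact: sumr_ge0.
rewrite big1 ?mulr0 // => S ES; apply: K0; apply/negP => /Emono /(_ ES).
by rewrite ES'.
Qed.

End RandomSet.

(** * Containers *)

Section GraphContainers.
Variables (R : realType) (V : finType) (r : rel V) (K beta : R).
Hypothesis beta01 : 0 <= beta <= 1.
Hypothesis dense : forall C : {set V}, K < #|C|%:R ->
  exists2 v, v \in C & beta * #|C|%:R <= #|[set z in C | r v z]|%:R.

Definition independent (I : {set V}) : Prop :=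
  forall y z, y \in I -> z \in I -> ~~ r y z.

(* Kleitman-Winston: branch on whether a vertex of large degree lies in the
   independent set; if it does, its neighbourhood leaves the container. *)
Lemma graph_containers (s : nat) (C : {set V}) :
  (1 - beta) ^+ s * #|C|%:R <= K ->
  exists D : {set {set V}},
    [/\ (#|D| <= #|C|.+1 ^ s)%N,
        forall X, X \in D -> #|X|%:R <= K + s%:R &
        forall I : {set V}, I \subset C -> independent I ->
          exists2 X, X \in D & I \subset X].
Proof.
elim: s C => [|s IHs] C.
  rewrite expr0 mul1r => hC; exists [set C]; split.
  - by rewrite cards1 expn0.
  - by move=> X; rewrite inE => /eqP ->; rewrite addr0.
  - by move=> I IC _; exists C; rewrite ?inE.
(* Rejecting a vertex uses up none of the [s] steps and only removes a point from [C], hence an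
   inner induction on [#|C|]; accepting one uses up a step. *)
have [n] := ubnP #|C|; elim: n C => // n IHn C; rewrite ltnS => hn hC.
have [CK|CK] := leP (#|C|%:R) K.
  exists [set C]; split.
  - by rewrite cards1 expn_gt0.
  - by move=> X; rewrite inE => /eqP ->; apply: le_trans CK _; rewrite lerDl.
  - by move=> I IC _; exists C; rewrite ?inE.
have [v vC hv] := dense CK.
have b0 : 0 <= 1 - beta by move: beta01; lra.
have cardv : #|C| = #|C :\ v|.+1 by rewrite (cardsD1 v) vC.
have [||D1 [D1card D1K D1I]] := IHn (C :\ v).
- by rewrite -ltnS -cardv.
- apply: le_trans hC; rewrite ler_wpM2l ?exprn_ge0 // ler_nat.
  by rewrite subset_leq_card // subD1set.
pose C' := C :\: [set z in C | r v z].
have C'card : #|C'|%:R <= (1 - beta) * #|C|%:R.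
  have nbC : [set z in C | r v z] \subset C.
    by apply/fintype.subsetP => z; rewrite inE => /andP[].
  rewrite cardsD (finset.setIidPr nbC) natrB ?subset_leq_card //; lra.
have [|D2 [D2card D2K D2I]] := IHs C'.
  apply: le_trans hC; rewrite exprSr -mulrA ler_wpM2l ?exprn_ge0 //.
exists (D1 :|: [set v |: X | X in D2]); split.
(* With [N = #|C|] the two branches give [N ^ s.+1 + N.+1 ^ s <= N.+1 ^ s.+1]. *)
- apply: leq_trans (leq_of_leqif (leq_card_setU _ _)) _.
  apply: leq_trans (leq_add D1card (leq_imset_card _ _)) _.
  have D2le : (#|D2| <= #|C|.+1 ^ s)%N.
    apply: leq_trans D2card _; case: (s) => // s'.
    by rewrite leq_exp2r // ltnS subset_leq_card // subsetDl.
  apply: leq_trans (leq_add (leqnn _) D2le) _.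
  rewrite -cardv expnS [leqRHS]expnS mulSn addnC leq_add2l leq_mul2l.
  by case: (s) => [|s']; rewrite ?expn0 ?leq_exp2r // ?leqnSn orbT.
- move=> X; rewrite inE => /orP[/D1K //|/imsetP[Y YD2 ->]].
  rewrite cardsU1 natrD; apply: le_trans (lerD (_ : _ <= 1) (D2K _ YD2)) _.
    by rewrite lern1; case: (_ \notin _).
  by rewrite -natr1; lra.
move=> I IC indI; have [vI|vI] := boolP (v \in I); last first.
  have [|X XD IX] := D1I I _ indI; last by exists X => //; rewrite inE XD.
  by rewrite subsetD1 IC.
have [||X XD IX] := D2I (I :\ v).
- apply/fintype.subsetP => z; rewrite !inE => /andP[zv zI].
  by rewrite (fintype.subsetP IC) // (negPf (indI _ _ vI zI)).
- by move=> y z; rewrite !inE => /andP[_ yI] /andP[_ zI]; apply: indI.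
exists (v |: X); first by rewrite inE imset_f ?orbT.
by rewrite -subDset.
Qed.

End GraphContainers.

(** Cauchy-Schwarz for the sizes of the colour classes, by summing
    [2 * (n i * n j) <= n i ^ 2 + n j ^ 2] over all pairs of colours. *)
Lemma monochromatic_pairs (V W : finType) (c : V -> W) (A : {set V}) :
  (#|A| ^ 2 <= #|W| * \sum_(y in A) #|[set z in A | c z == c y]|)%N.
Proof.
pose n w := #|[set z in A | c z == w]|.
have cardA : #|A| = (\sum_w n w)%N.
  rewrite -sum1_card (partition_big c xpredT) //=; apply: eq_bigr => w _.
  by rewrite /n -sum1_card; apply: eq_bigl => z; rewrite inE.
have sumA : (\sum_(y in A) #|[set z in A | c z == c y]| = \sum_w n w ^ 2)%N.
  rewrite (partition_big c xpredT) //=; apply: eq_bigr => w _.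
  rewrite (eq_bigr (fun=> n w)) => [|y /andP[_ /eqP <-]] //.
  rewrite sum_nat_const -mulnn; congr (_ * _)%N.
  by apply: eq_card => z; rewrite !inE.
rewrite cardA sumA -(leq_pmul2l (m := 2)) // -mulnn big_distrlr /=.
rewrite big_distrr /=.
under eq_bigr do rewrite big_distrr /=.
apply: (@leq_trans (\sum_(i : W) \sum_(j : W) (n i ^ 2 + n j ^ 2))).
  apply: leq_sum => i _; apply: leq_sum => j _; exact: nat_Cauchy.
under eq_bigr do rewrite big_split /= sum_nat_const.
by rewrite big_split /= -big_distrr /= sum_nat_const addnn -mul2n.
Qed.

(** * Lines and arcs in the affine plane *)

Section Plane.
Variable F : finFieldType.
Local Notation plane := 'rV[F]_2.
Local Notation q := #|F|.
Implicit Types (x y z a v : plane) (A C I S : {set plane}).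

Lemma mem_lineP x a v : reflect (exists t, x = a + t *: v) (x \in line a v).
Proof.
by apply: (iffP imsetP) => [[t _ ->]|[t ->]]; exists t.
Qed.

Lemma line_src x v : x \in line x v.
Proof. by apply/mem_lineP; exists 0; rewrite scale0r addr0. Qed.

Lemma line_tgt x y : y \in line x (y - x).
Proof. by apply/mem_lineP; exists 1; rewrite scale1r addrC subrK. Qed.

Lemma line_sub a v x y : x \in line a v -> y \in line a v -> x != y ->
  line a v \subset line x (y - x).
Proof.
move=> /mem_lineP[t ->] /mem_lineP[u ->] neq.
have tu : u - t != 0.
  by apply: contraNneq neq => /subr0_eq ->.
apply/fintype.subsetP => z /mem_lineP[w ->]; apply/mem_lineP.
exists ((w - t) / (u - t)); rewrite opprD addrACA subrr add0r -scalerBl.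
by rewrite scalerA divfK // -addrA -scalerDl (addrC t) subrK.
Qed.

Lemma ctfP A : reflect
  (forall x y z, x \in A -> y \in A -> z \in A -> x != y -> y != z -> z != x ->
     z \notin line x (y - x))
  (collinear_triple_free A).
Proof.
apply: (iffP forallP) => [ctfA x y z xA yA zA xy yz zx|ctfA T].
  apply/negP => zl; have /implyP := ctfA [set x; y; z].
  have -> /= : [set x; y; z] \subset A.
    by apply/fintype.subsetP => w; rewrite !inE -orbA => /or3P[] /eqP ->.
  rewrite finset.setUC cardsU1 cards2 !inE negb_or xy zx (eq_sym z) yz /= => /(_ isT).
  move/existsP; case; exists x; apply/existsP; exists (y - x).
  rewrite subr_eq0 eq_sym xy; apply/fintype.subsetP => w.
  by rewrite !inE => /or3P[] /eqP -> //; rewrite ?line_src ?line_tgt.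
apply/implyP => /andP[TA /eqP cT]; apply/negP => /existsP[a /existsP[v]].
move=> /andP[_ Tl]; have : (2 < #|T|)%N by rewrite cT.
case/card_gt2P => x [y [z [[xT yT zT] [xy yz zx]]]].
have inA w : w \in T -> w \in A by apply/fintype.subsetP.
have /negP[] := ctfA x y z (inA _ xT) (inA _ yT) (inA _ zT) xy yz zx.
have inl w : w \in T -> w \in line a v by apply/fintype.subsetP.
by apply: (fintype.subsetP (line_sub (inl _ xT) (inl _ yT) xy)); apply: inl.
Qed.

Lemma ctf_sub A A' : A \subset A' ->
  collinear_triple_free A' -> collinear_triple_free A.
Proof.
move=> /fintype.subsetP AA' /ctfP h; apply/ctfP => x y z xA yA zA.
by apply: h; apply: AA'.
Qed.

Lemma leq_alpha A S : A \subset S -> collinear_triple_free A ->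
  (#|A| <= alpha S)%N.
Proof. by move=> AS ctfA; apply: leq_bigmax_cond; rewrite AS. Qed.

Lemma alpha_attained S :
  exists2 A : {set plane}, A \subset S /\ collinear_triple_free A & #|A| = alpha S.
Proof.
have P0 : (finset.set0 \subset S) && @collinear_triple_free F finset.set0.
  by rewrite finset.sub0set; apply/ctfP => x y z; rewrite inE.
rewrite /alpha (bigop.bigmax_eq_arg finset.set0) //.
by case: arg_maxnP => // A /andP[AS ctfA] _; exists A.
Qed.

Lemma alpha_le_card S : (alpha S <= #|S|)%N.
Proof. by have [A [AS _] <-] := alpha_attained S; apply: subset_leq_card. Qed.

Lemma alpha_mono S S' : S \subset S' -> (alpha S <= alpha S')%N.
Proof.
move=> SS'; have [A [AS ctfA] <-] := alpha_attained S.
by apply: leq_alpha => //; apply: fintype.subset_trans SS'.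
Qed.

Definition collinear_triples : {set {set plane}} :=
  [set T : {set plane} | (#|T| == 3%N) && collinear T].

Lemma alpha_deletion S :
  (#|S| <= alpha S + #|[set T in collinear_triples | T \subset S]|)%N.
Proof.
set Z := [set T in _ | _].
(* The point to delete from each triple. The default [0] never matters, as a triple is nonempty. *)
pose pt (T : {set plane}) : plane := odflt 0 [pick x in T].
rewrite addnC -leq_subLR; apply: (@leq_trans #|S :\: pt @: Z|).
  rewrite cardsD leq_sub2l //; apply: leq_trans (leq_imset_card pt Z).
  exact/subset_leq_card/finset.subsetIr.
apply: leq_alpha; first exact: finset.subsetDl.
apply/forallP => T; apply/implyP => /andP[TA cT]; apply/negP => colT.
have ptT : pt T \in T.
  rewrite /pt; case: pickP => [x //|T0]; move: cT.
  by rewrite eq_card0.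
have := fintype.subsetP TA _ ptT; rewrite inE imset_f // !inE cT colT /=.
exact: fintype.subset_trans TA (finset.subsetDl _ _).
Qed.

Lemma card_plane : #|plane| = (q ^ 2)%N.
Proof. by rewrite card_mx. Qed.

(** A collinear triple is determined by two of its points and the parameter of the third on the line
    through them: [q ^ 2 * q ^ 2 * q] choices. *)
Lemma card_collinear_triples : (#|collinear_triples| <= q ^ 5)%N.
Proof.
pose g (w : plane * plane * F) := [set w.1.1; w.1.2; w.1.1 + w.2 *: (w.1.2 - w.1.1)].
apply: (@leq_trans #|g @: [set: plane * plane * F]|); last first.
  by apply: leq_trans (leq_imset_card _ _) _; rewrite cardsT !card_prod card_plane -expnD -expnSr.
apply: subset_leq_card; apply/fintype.subsetP => T; rewrite inE.
case/andP=> /eqP cT /existsP[a /existsP[v /andP[_ Tl]]].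
have : (2 < #|T|)%N by rewrite cT.
case/card_gt2P => x [y [z [[xT yT zT] [xy yz zx]]]].
have inl w : w \in T -> w \in line a v by apply/fintype.subsetP.
have /mem_lineP[t zE] : z \in line x (y - x).
  by apply: (fintype.subsetP (line_sub (inl _ xT) (inl _ yT) xy)); apply: inl.
apply/imsetP; exists (x, y, t) => //; rewrite /g /= -zE.
apply/eqP; rewrite eq_sym eqEcard cT; apply/andP; split.
  by apply/fintype.subsetP => w; rewrite !inE -orbA => /or3P[] /eqP ->.
by rewrite finset.setUC cardsU1 cards2 !inE negb_or xy zx (eq_sym z) yz.
Qed.

Definition parabola : {set plane} :=
  [set \row_(i < 2) (if i == 0 then t else t ^+ 2) | t : F].

Lemma card_parabola : #|parabola| = q.
Proof.
rewrite card_imset // => s t /rowP /(_ 0); by rewrite !mxE.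
Qed.

Lemma ctf_parabola : collinear_triple_free parabola.
Proof.
apply/ctfP => x y z /imsetP[r _ ->] /imsetP[s _ ->] /imsetP[t _ ->] rs st tr.
apply/negP => /mem_lineP[c /rowP h].
have := h 0; have := h 1; rewrite !mxE /= => h1 h0.
(* The chord between parameters [r] and [s] has slope [s + r], so the condition that it meets the
   parabola at [t] factors. This works in every characteristic. *)
have e : (t - r) * (t - s) = 0.
  have e0 : t - r = c * (s - r) by rewrite h0; ring.
  have e1 : (t - r) * (t + r) = c * (s - r) * (s + r).
    by rewrite -subr_sqr h1; ring.
  have -> : (t - r) * (t - s) = (t - r) * (t + r) - (t - r) * (s + r) by ring.
  by rewrite e1 -e0 subrr.
move/eqP: e; rewrite mulf_eq0 !subr_eq0 => /orP[] /eqP e.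
  by rewrite e eqxx in tr.
by rewrite e eqxx in st.
Qed.

(** [None] is the vertical direction, so the [q + 1] values index the lines through [x]. The value
    at [y = x] is also [None], hence [x] is removed before counting. *)
Definition slope x y : option F :=
  let w := y - x in if w 0 0 == 0 then None else Some (w 0 1 / w 0 0).

Lemma slope_eq_line x y z : y != x -> slope x z = slope x y ->
  z \in line x (y - x).
Proof.
rewrite /slope -subr_eq0 => yx h; apply/mem_lineP.
suff [c hc] : exists c, z - x = c *: (y - x).
  by exists c; rewrite -hc addrC subrK.
move: (y - x) (z - x) yx h => w u w0.
have ext (a b : plane) : a 0 0 = b 0 0 -> a 0 1 = b 0 1 -> a = b.
  move=> h0 h1; apply/rowP => i; case: i => [[|[|//]]] hi.
    by have -> : Ordinal hi = 0 by apply/val_inj.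
  by have -> : Ordinal hi = 1 by apply/val_inj.
case: eqP => u00; case: eqP => w00 //.
  move=> _; have w01 : w 0 1 != 0.
    by apply: contraNneq w0 => w01; apply/eqP/ext; rewrite mxE.
  by exists (u 0 1 / w 0 1); apply: ext; rewrite !mxE ?u00 ?w00 ?mulr0 ?divfK.
move/eqP: w00 => w00; move/eqP: u00 => u00 [h].
exists (u 0 0 / w 0 0); apply: ext; rewrite !mxE ?divfK //.
by rewrite mulrAC -mulrA -h mulrC divfK.
Qed.

(** * Pairs collinear with a point of a fixed arc *)

Section SecantGraph.
Variable F0 : {set plane}.

Definition collinear_through y z :=
  [set x in F0 | [&& x != y, x != z & z \in line x (y - x)]].

(* [y] and [z] are adjacent if they lie on a common line with a third point of
   [F0]: collinear-triple-free supersets of [F0] are independent. *)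
Definition secant_graph : rel plane :=
  fun y z => (y != z) && (collinear_through y z != finset.set0).

Lemma secant_graph_independent I y z : F0 \subset I ->
  collinear_triple_free I -> y \in I -> z \in I -> ~~ secant_graph y z.
Proof.
move=> /fintype.subsetP FI /ctfP ctfI yI zI; apply/negP => /andP[yz].
case/set0Pn => x; rewrite inE => /and4P[xF xy xz zl].
by have := ctfI x y z (FI _ xF) yI zI xy yz; rewrite eq_sym xz zl => /(_ isT).
Qed.

Hypothesis ctfF0 : collinear_triple_free F0.

(** All these points lie on the line through [y] and [z], which meets the arc [F0] at most twice. *)
Lemma card_collinear_through y z : y != z -> (#|collinear_through y z| <= 2)%N.
Proof.
move=> yz; rewrite leqNgt; apply/negP => /card_gt2P.
move=> [a [b [c [[aX bX cX] [ab bc ca]]]]].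
have onl x : x \in collinear_through y z -> x \in F0 /\ x \in line y (z - y).
  rewrite inE => /and4P[xF xy xz zl]; split => //.
  apply: (fintype.subsetP (line_sub _ zl yz)); [exact: line_tgt|exact: line_src].
have [aF al] := onl _ aX; have [bF bl] := onl _ bX; have [cF cl] := onl _ cX.
have /ctfP h := ctfF0; have /negP[] := h a b c aF bF cF ab bc ca.
exact: (fintype.subsetP (line_sub al bl ab)).
Qed.

(** The diagonal is excluded because [collinear_through y y] contains every point of [F0] other than
    [y]. *)
Definition secant_pairs C x :=
  \sum_(y in C) #|[set z in C | x \in collinear_through y z & y != z]|.

(** Double counting: an ordered adjacent pair is counted once for each point of
    [collinear_through y z], so at most twice. *)
Lemma sum_secant_pairs_le C :
  (\sum_(x in F0) secant_pairs C x <=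
   2 * \sum_(y in C) #|[set z in C | secant_graph y z]|)%N.
Proof.
rewrite exchange_big big_distrr /=; apply: leq_sum => y yC.
under eq_bigr do rewrite -sum1_card big_mkcond /=.
rewrite exchange_big /= -sum1_card big_distrr [leqRHS]big_mkcond /=.
apply: leq_sum => z _; rewrite inE /secant_graph.
have [zC|zC] /= := boolP (z \in C); last first.
  by rewrite big1 // => x _; rewrite inE (negPf zC).
have [yz|yz] /= := eqVneq y z.
  by rewrite big1 // => x _; rewrite !inE yz eqxx !andbF.
have -> : (\sum_(x in F0) (if z \in [set z in C | x \in collinear_through y z & y != z]
    then 1 else 0) = #|collinear_through y z|)%N.
  rewrite -sum1_card -big_mkcondr /=; apply: eq_bigl => x.
  by rewrite !inE zC yz andbT; case: (x \in F0).
by case: eqP => [->|_]; rewrite ?cards0 // muln1 card_collinear_through.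
Qed.

(** Colour the points other than [x] by their slope from [x]: two distinct points of one colour are
    collinear with [x]. The summand [#|C :\ x|] pays for the diagonal pairs. *)
Lemma secant_pairs_ge C x : x \in F0 ->
  (#|C :\ x| ^ 2 <= q.+1 * (secant_pairs C x + #|C :\ x|))%N.
Proof.
move=> xF; apply: leq_trans (monochromatic_pairs (slope x) (C :\ x)) _.
rewrite card_option leq_mul2l /=.
apply: (@leq_trans (\sum_(y in C :\ x)
    (#|[set z in C | x \in collinear_through y z & y != z]| + 1))); last first.
  by rewrite big_split /= sum1_card leq_add2r [leqRHS](big_setID [set x]) leq_addl.
apply: leq_sum => y; rewrite !inE => /andP[yx yC].
rewrite (cardsD1 y) addnC; apply: leq_add; last by case: (_ \in _).
apply: subset_leq_card; apply/fintype.subsetP => z; rewrite !inE.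
case/andP=> zy /andP[/andP[zx zC] /eqP sl].
by rewrite zC xF eq_sym yx eq_sym zx slope_eq_line // eq_sym zy.
Qed.

Lemma secant_graph_dense (R : realType) (delta : R) C :
  0 < delta <= 1 -> 8 <= delta * q%:R ->
  (1 + delta) * q%:R < #|C|%:R ->
  exists2 v, v \in C &
    #|F0|%:R * delta / (32 * q%:R) * #|C|%:R <=
    #|[set z in C | secant_graph v z]|%:R :> R.
Proof.
move=> hd hdq hC; set n : R := #|C|%:R; set Q : R := q%:R.
have Q0 : 0 < Q by nra.
set beta := _ / _.
have hpairs x : x \in F0 -> n ^+ 2 * delta / (16 * Q) <= (secant_pairs C x)%:R.
  move=> xF; have := secant_pairs_ge C xF.
  rewrite -(ler_nat R) natrX natrM natrD -natr1.
  have : n - 1 <= #|C :\ x|%:R.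
    by rewrite /n (cardsD1 x) natrD lerBlDl lerD2r lern1; case: (_ \in _).
  rewrite -/Q; move: (#|C :\ x|%:R : R) ((secant_pairs C x)%:R : R) => a m ha hm.
  (* Since [n] exceeds [(1 + delta) * Q], it exceeds [Q] by a multiple of [n * delta]; the
     assumption [8 <= delta * Q] absorbs the constant 2. *)
  have h1 : n * delta / 4 <= n - Q - 2 by nra.
  have h2 : n / 2 <= n - 1 by nra.
  have h3 : n / 2 * (n * delta / 4) <= (Q + 1) * m.
    apply: (@le_trans _ _ (a * (a - (Q + 1)))); last by nra.
    by apply: ler_pM; nra.
  have m0 : 0 <= m by nra.
  rewrite ler_pdivrMr; last by nra.
  nra.
apply: contrapT => hv.
have hv' v : v \in C -> #|[set z in C | secant_graph v z]|%:R < beta * n.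
  by move=> vC; rewrite ltNge; apply/negP => h; apply: hv; exists v.
have n0 : 0 < n by nra.
have := sum_secant_pairs_le C; rewrite leqNgt => /negP; apply.
rewrite -(ltr_nat R) natrM !natr_sum.
(* If all degrees were below [beta * n], twice their sum would be below [2 * (n * (beta * n))];
   [beta] is chosen so that this equals the sum of the lower bounds [hpairs]. *)
apply: (@lt_le_trans _ _ (2 * (n * (beta * n)))).
  rewrite ltr_pM2l // {1}/n mulr_natl -sumr_const.
  have /card_gt0P[v vC] : (0 < #|C|)%N by rewrite -(ltr_nat R).
  by apply: ltr_sum; [apply/hasP; exists v; rewrite ?mem_index_enum|exact: hv'].
apply: le_trans (ler_sum _ hpairs); rewrite sumr_const -mulr_natl /beta.
by rewrite le_eqVlt; apply/orP; left; apply/eqP; field; rewrite gt_eqF.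
Qed.

End SecantGraph.

(** Each [f]-point arc [F0] yields containers for the arcs containing it. In the exponent, [f] pays
    for listing [F0] as a tuple and [s] for the algorithm. The last hypothesis says that [s] steps
    shrink the plane from [q ^ 2] points to at most [q]. *)
Lemma arc_containers (R : realType) (delta : R) (f s : nat) :
  0 < delta <= 1 -> 8 <= delta * q%:R -> (f <= q)%N ->
  (1 - f%:R * delta / (32 * q%:R)) ^+ s * (q%:R ^+ 2) <= q%:R ->
  exists D : {set {set plane}},
    [/\ (#|D| <= (q ^ 2).+1 ^ (f + s))%N,
        forall X, X \in D -> #|X|%:R <= (1 + delta) * q%:R + s%:R &
        forall I, collinear_triple_free I -> (f <= #|I|)%N ->
          exists2 X, X \in D & I \subset X].
Proof.
move=> hd hdq fq hs.
have Q0 : 0 < q%:R :> R by nra.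
have hb : (0 : R) <= f%:R * delta / (32 * q%:R) <= 1.
  apply/andP; split; first by rewrite divr_ge0 ?mulr_ge0 ?ler0n //; lra.
  rewrite ler_pdivrMr; last by nra.
  have : (f%:R : R) <= q%:R by rewrite ler_nat.
  by have : 0 <= (f%:R : R) by []; nra.
have /choice[D hD] (F0 : {set plane}) : exists D : {set {set plane}},
    collinear_triple_free F0 -> #|F0| = f ->
    [/\ (#|D| <= (q ^ 2).+1 ^ s)%N,
        forall X, X \in D -> #|X|%:R <= (1 + delta) * q%:R + s%:R &
        forall I, F0 \subset I -> collinear_triple_free I ->
          exists2 X, X \in D & I \subset X].
  (* If [F0] is not an [f]-point arc, the claim is void and the empty family serves. *)
  have [ctfF0|/negP nctf] := boolP (collinear_triple_free F0); last by exists finset.set0.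
  have [cF0|cF0] := eqVneq #|F0| f; last by exists finset.set0 => _ /eqP; rewrite (negPf cF0).
  have dense C := @secant_graph_dense F0 ctfF0 R delta C hd hdq.
  rewrite cF0 in dense.
  have [|D [D1 D2 D3]] := graph_containers hb dense (s := s) (C := finset.setT).
    rewrite cardsT card_plane natrX; apply: le_trans hs _; nra.
  exists D => _ _; split => //; first by rewrite cardsT card_plane in D1.
  move=> I FI ctfI; apply: D3; first exact: finset.subsetT.
  by move=> y z; apply: secant_graph_independent.
pose good (F0 : {set plane}) := collinear_triple_free F0 && (#|F0| == f).
exists (\bigcup_(t : f.-tuple plane | good [set x in t]) D [set x in t]); split.
- apply: (@leq_trans (\sum_(t : f.-tuple plane) (q ^ 2).+1 ^ s)).
    rewrite [leqRHS](bigID (fun t : f.-tuple plane => good [set x in t])) /=.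
    apply: leq_trans (leq_addr _ _).
    elim/big_rec2: _ => [|t k U /andP[ctft /eqP ct] hU]; first by rewrite cards0.
    apply: leq_trans (leq_of_leqif (leq_card_setU _ _)) _.
    by rewrite leq_add //; case: (hD _ ctft ct).
  rewrite sum_nat_const card_tuple card_plane expnD leq_mul2r; apply/orP; right.
  by case: (f) => [|k]; rewrite ?expn0 // leq_exp2r.
- move=> X /bigcupP[t /andP[ctft /eqP ct] XD].
  by case: (hD _ ctft ct) => _ + _; apply.
move=> I ctfI /card_geqP[l [ul sl lI]].
pose t := Tuple (introT eqP sl).
have tI : [set x in t] \subset I by apply/fintype.subsetP => x; rewrite inE => /lI.
have ct : #|[set x in t]| = f by rewrite cardsE -[RHS]sl; apply: (card_uniqP ul).
have ctft := ctf_sub tI ctfI.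
have [_ _ /(_ I tI ctfI)[X XD IX]] := hD _ ctft ct.
by exists X => //; apply/bigcupP; exists t; rewrite // /good ctft ct eqxx.
Qed.

End Plane.

(** * Tail bounds *)

Lemma prime_power_card (F : finFieldType) : prime_power #|F|.
Proof.
have [l l_prime lF] := finPcharP F.
exists l, (logn l #|F|); have cF := card_pprimeChar lF; split => //.
by rewrite lt0n; apply/eqP => h; have := finNzRing_gt1 F; rewrite cF h.
Qed.

Lemma exp_le_inv (R : realType) (x : R) : 0 < x -> expR (- x) <= x^-1.
Proof.
move=> x0; rewrite expRN lef_pV2 ?posrE ?expR_gt0 //.
by apply: le_trans (expR_ge1Dx _); lra.
Qed.

Section Tails.
Variables (R : realType) (F : finFieldType) (p : R).
Hypothesis p01 : 0 <= p <= 1.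
Local Notation q := #|F|.
Local Notation Prob E := (prob_random_set p (E : pred {set 'rV[F]_2})).

(** Only [alpha S <= #|S|] is used, with Chernoff's bound at [lam = 1 / 4] for the whole plane. *)
Lemma alpha_upper_tail :
  Prob (fun S => 3 * (p * q%:R ^+ 2) <= (alpha S)%:R) <=
  expR (- (p * q%:R ^+ 2 / 4)).
Proof.
have hl : (1 / 4 : R) <= 1 / 4 by [].
have := @chernoff_card R _ p [set: 'rV[F]_2] (1 / 4) (3 * (p * q%:R ^+ 2)) p01 hl.
move=> h; apply: le_trans (le_trans _ h) _.
  apply: prob_mono => // S hS; rewrite ler_pM2l; last by lra.
  by rewrite finset.setIT; apply: le_trans hS _; rewrite ler_nat alpha_le_card.
rewrite ler_expR cardsT card_plane natrX.
have : 0 <= p * q%:R ^+ 2 by rewrite mulr_ge0 ?exprn_ge0 //; case/andP: p01.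
lra.
Qed.

Lemma expected_collinear_triples :
  \sum_(S : {set 'rV[F]_2}) mass p S *
     #|[set T in collinear_triples F | T \subset S]|%:R <= p ^+ 3 * q%:R ^+ 5.
Proof.
have p0 : 0 <= p by case/andP: p01.
apply: (@le_trans _ _ (\sum_(T in collinear_triples F) p ^+ 3)); last first.
  rewrite sumr_const -[leLHS]mulr_natr ler_wpM2l ?exprn_ge0 // -natrX ler_nat.
  exact: card_collinear_triples.
rewrite [leRHS](eq_bigr (fun T : {set _} => Prob (fun S => T \subset S))); last first.
  by move=> T; rewrite inE prob_superset => /andP[/eqP ->].
rewrite /prob_random_set (exchange_big_dep xpredT) //= le_eqVlt.
apply/orP; left; apply/eqP; apply: eq_bigr => S _.
rewrite -sum1_card natr_sum mulr_sumr; apply: eq_big => [T|T _].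
  by rewrite inE.
by rewrite mulr1.
Qed.

(** If [alpha] is small, then either the random set has at most half its expected size (Chernoff
    with [lam = - (1 / 4)]) or it contains at least [X / 4] collinear triples (Markov). *)
Lemma alpha_deletion_tail : 0 < p ->
  Prob (fun S => ~~ (1 / 4 * (p * q%:R ^+ 2) <= (alpha S)%:R)) <=
  expR (- (p * q%:R ^+ 2 / 16)) + 4 * (p ^+ 2 * q%:R ^+ 3).
Proof.
move=> p_gt0; have q0 : 0 < q%:R :> R by rewrite ltr0n; apply/card_gt0P; exists 0.
set X := p * q%:R ^+ 2; have X0 : 0 < X by rewrite mulr_gt0 ?exprn_gt0.
pose E1 (S : {set 'rV[F]_2}) := - (1 / 4) * (X / 2) <= - (1 / 4) * #|S :&: [set: _]|%:R.
pose Z (S : {set 'rV[F]_2}) := #|[set T in collinear_triples F | T \subset S]|%:R : R.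
pose E2 S := X / 4 <= Z S.
apply: (@le_trans _ _ (Prob (fun S => E1 S || E2 S))).
  apply: prob_mono => // S; rewrite -ltNge => hS; apply: contraTT hS.
  rewrite negb_or /E1 /E2 -!ltNge finset.setIT -leNgt => /andP[h1 h2].
  have : (#|S|%:R : R) <= (alpha S)%:R + Z S.
    by rewrite /Z -natrD ler_nat; exact: alpha_deletion.
  lra.
apply: le_trans (probU_le _ _ p01) _; apply: lerD.
  have hl : (- (1 / 4) : R) <= 1 / 4 by lra.
  apply: le_trans (@chernoff_card R _ p [set: 'rV[F]_2] _ _ p01 hl) _.
  rewrite ler_expR cardsT card_plane natrX -/X; lra.
have Xq : 0 < X / 4 by lra.
rewrite -(ler_pM2l Xq); apply: le_trans (markov_random_set (h := Z) p01 _ _) _.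
- by move=> S; rewrite ler0n.
- by [].
apply: le_trans expected_collinear_triples _.
by rewrite le_eqVlt; apply/orP; left; apply/eqP; rewrite /X; field.
Qed.

(** The points of [S] on the parabola form an arc of expected size [p * q]; Chernoff's bound is
    applied with [lam = - eta]. *)
Lemma alpha_parabola_tail (eta : R) : 0 < eta ->
  Prob (fun S => ~~ ((1 - 2 * eta) * (p * q%:R) <= (alpha S)%:R)) <=
  expR (- (p * q%:R * eta ^+ 2)).
Proof.
move=> eta0; have hl : - eta <= 1 / 4 by lra.
have := @chernoff_card R _ p (parabola F) (- eta) ((1 - 2 * eta) * (p * q%:R)) p01 hl.
move=> h; apply: le_trans (le_trans _ h) _.
  apply: prob_mono => // S; rewrite -ltNge => hS.
  rewrite !mulNr lerN2 ler_pM2l //; apply: le_trans (ltW hS); rewrite ler_nat.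
  apply: leq_alpha; first exact: finset.subsetIl.
  by apply: ctf_sub (ctf_parabola F); apply: finset.subsetIr.
by rewrite ler_expR card_parabola; lra.
Qed.

(** A largest arc in [S] lies in some container [X], so [S :&: X] has at least [m] points; then a
    union bound over [D]. *)
Lemma alpha_container_tail (D : {set {set 'rV[F]_2}}) (f : nat) (b lam m : R) :
  0 < lam <= 1 / 4 -> (forall X, X \in D -> #|X|%:R <= b) ->
  (forall I, collinear_triple_free I -> (f <= #|I|)%N ->
     exists2 X, X \in D & I \subset X) ->
  f%:R <= m ->
  Prob (fun S => m <= (alpha S)%:R) <=
  #|D|%:R * expR (p * b * (lam + lam ^+ 2) - lam * m).
Proof.
move=> hl Db Dcov fm.
have p0 : 0 <= p by case/andP: p01.
pose E X (S : {set 'rV[F]_2}) := lam * m <= lam * #|S :&: X|%:R.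
apply: (@le_trans _ _ (Prob (fun S => [exists X in D, E X S]))).
  apply: prob_mono => // S hS; have [A [AS ctfA] cA] := alpha_attained S.
  have [|X XD AX] := Dcov A ctfA.
    by rewrite cA -(ler_nat R); apply: le_trans hS.
  apply/exists_inP; exists X => //; rewrite /E ler_pM2l; last by lra.
  apply: le_trans hS _; rewrite ler_nat -cA subset_leq_card //.
  by rewrite finset.subsetI AS.
apply: prob_union_le => // X XD; rewrite /E.
apply: le_trans (chernoff_card _ _ p01 _) _; first by lra.
rewrite ler_expR lerD2r ler_wpM2r //; first by nra.
by rewrite ler_wpM2l // Db.
Qed.

End Tails.

(** * The three ranges of [p] over a fixed large field, where [L] is the logarithm of [q] and [Y]
    its square root *)

Section LargeField.
Variables (R : realType) (F : finFieldType) (L Y : R).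
Local Notation q := #|F|.
Hypothesis expL : q%:R = expR L.
Hypothesis sqrY : q%:R = Y ^+ 2.
(* With [L >= 212] the saving [L ^+ 4 / 2] in Chernoff's bound beats the entropy
   [105 * L ^+ 3] of the containers. *)
Hypothesis L_large : 212 <= L.
Hypothesis LY : L ^+ 9 <= Y.

Let q_gt0 : 0 < q%:R :> R.
Proof. by rewrite expL expR_gt0. Qed.

Let L_gt0 : 0 < L.
Proof. by move: L_large; lra. Qed.

Let LnY n : (n <= 9)%N -> L ^+ n <= Y.
Proof.
move=> n9; apply: le_trans LY; apply: ler_weXn2l => //.
by move: L_large; lra.
Qed.

Let L_le_Y : L <= Y.
Proof. exact: (LnY (isT : (1 <= 9)%N)). Qed.

Let Y_ge : 212 <= Y.
Proof. exact: le_trans L_large L_le_Y. Qed.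

Lemma arc_tail (p lam m : R) : 0 <= p <= 1 -> 0 < lam <= 1 / 4 -> 2 * Y <= m ->
  prob_random_set p (fun S : {set 'rV[F]_2} => m <= (alpha S)%:R) <=
  expR (105 * L ^+ 3 * Y + p * ((1 + 2 / L) * q%:R) * (lam + lam ^+ 2)
        - lam * m).
Proof.
move=> hp hlam hm.
(* With [delta = L^-1], these sizes give [s * beta >= L], so [s] steps gain a factor
   [expR (- L) = 1 / q], while [s] stays below [q / L]. *)
pose f := (Num.truncn Y).+1; pose s := (Num.truncn (32 * L ^+ 2 * Y)).+1.
have Y0 : 0 <= Y by move: Y_ge; lra.
have fl : Y <= f%:R by apply/ltW/truncnS_gt.
have fu : f%:R <= Y + 1 by rewrite /f -natr1 lerD2r truncn_le.
have L2Y : 0 <= 32 * L ^+ 2 * Y by rewrite !mulr_ge0 ?exprn_ge0 // ltW.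
have sl : 32 * L ^+ 2 * Y <= s%:R by apply/ltW/truncnS_gt.
have su : s%:R <= 32 * L ^+ 2 * Y + 1 by rewrite /s -natr1 lerD2r truncn_le.
have L2 : 1 <= L ^+ 2 by rewrite expr_ge1 //; move: L_large; lra.
have Linv : 0 < L^-1 by rewrite invr_gt0.
have LLinv : L * L^-1 = 1 by rewrite mulfV // gt_eqF.
have hd : 0 < L^-1 <= 1 by rewrite Linv invf_le1 //; move: L_large; lra.
have L3Y : 40 * L ^+ 3 <= Y.
  apply: le_trans (LnY (isT : (4 <= 9)%N)); rewrite [L ^+ 4]exprSr mulrC ler_pM2l ?exprn_gt0 //.
  by move: L_large; lra.
have hdq : 8 <= L^-1 * q%:R.
  rewrite sqrY mulrC ler_pdivlMr //.
  move: L_le_Y Y_ge; nra.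
have fq : (f <= q)%N.
  rewrite -(ler_nat R) sqrY; apply: le_trans fu _; move: Y_ge; nra.
have hs : (1 - f%:R * L^-1 / (32 * q%:R)) ^+ s * q%:R ^+ 2 <= q%:R.
  set beta := _ / _.
  have b1 : beta <= 1.
    rewrite ler_pdivrMr ?mul1r; last by rewrite mulr_gt0.
    have : (f%:R : R) <= q%:R by rewrite ler_nat.
    have : 0 <= (f%:R : R) by [].
    by case/andP: hd => _; move: q_gt0; nra.
  have bs : L <= s%:R * beta.
    rewrite /beta mulrA ler_pdivlMr; last by rewrite mulr_gt0.
    rewrite mulrA ler_pdivlMr // sqrY.
    apply: (@le_trans _ _ (32 * L ^+ 2 * Y * Y)); last by apply: ler_pM.
    by rewrite le_eqVlt; apply/orP; left; apply/eqP; ring.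
  apply: (@le_trans _ _ (expR (- L) * q%:R ^+ 2)).
    rewrite ler_pM2r ?exprn_gt0 //.
    apply: (@le_trans _ _ (expR (- beta) ^+ s)).
      apply: lerXn2r; rewrite ?nnegrE ?expR_ge0 ?subr_ge0 //.
      exact: expR_ge1Dx.
    by rewrite -expRM_natl ler_expR mulrN lerN2.
  by rewrite expRN -expL expr2 mulrA mulVf ?mul1r // gt_eqF.
have [D [Dcard Dsize Dcov]] := arc_containers hd hdq fq hs.
have Db X : X \in D -> #|X|%:R <= (1 + 2 / L) * q%:R.
  move=> /Dsize h; apply: le_trans h _.
  have : s%:R <= q%:R / L; last by lra.
  rewrite ler_pdivlMr // sqrY; apply: (@le_trans _ _ (33 * L ^+ 2 * Y * L)).
    rewrite ler_pM2r //; apply: le_trans su _.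
    by move: Y_ge; nra.
  rewrite (_ : _ * L = 33 * L ^+ 3 * Y); last by ring.
  rewrite expr2 ler_wpM2r //; apply: le_trans L3Y.
  by rewrite ler_wpM2r ?exprn_ge0 // ?ltW //; lra.
have fm : f%:R <= m by apply: le_trans fu _; apply: le_trans hm; move: Y_ge; lra.
apply: le_trans (alpha_container_tail hp hlam Db Dcov fm) _.
rewrite -(addrA (105 * L ^+ 3 * Y)) [leRHS]expRD ler_wpM2r ?expR_ge0 //.
(* The entropy: [q ^ 2 + 1 <= q ^ 3 = expR (3 * L)] and [f + s <= 35 * L ^+ 2 * Y], whence the
   constant 105. *)
apply: (@le_trans _ _ (expR (3 * L) ^+ (f + s))).
  apply: (@le_trans _ _ (((q ^ 2).+1 ^ (f + s))%:R)); first by rewrite ler_nat.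
  rewrite natrX; apply: lerXn2r; rewrite ?nnegrE ?expR_ge0 //.
  rewrite -natr1 natrX expRM_natl -expL.
  have : 2 <= q%:R :> R by rewrite sqrY; move: Y_ge; nra.
  by rewrite [_ ^+ 3]exprS; nra.
rewrite -expRM_natl ler_expR natrD.
apply: (@le_trans _ _ (35 * L ^+ 2 * Y * (3 * L))); last first.
  by rewrite le_eqVlt; apply/orP; left; apply/eqP; ring.
rewrite ler_pM2r ?mulr_gt0 //.
by move: Y_ge; nra.
Qed.

Lemma exp_neg_le_invL (x : R) : L <= x -> expR (- x) <= L^-1.
Proof.
move=> Lx; have x0 : 0 < x by apply: lt_le_trans Lx.
by apply: le_trans (exp_le_inv x0) _; rewrite lef_pV2 ?posrE.
Qed.

Lemma deletion_regime (p : R) : 0 <= p <= 1 ->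
  16 * L <= p * q%:R ^+ 2 -> p * Y ^+ 3 * L ^+ 6 <= 1 ->
  prob_random_set p (fun S : {set 'rV[F]_2} =>
    ~~ (1 / 4 * (p * q%:R ^+ 2) <= (alpha S)%:R)) <= 2 / L.
Proof.
move=> hp lo hi.
have p0 : 0 < p.
  rewrite lt_neqAle; case/andP: hp => -> _; rewrite andbT eq_sym.
  by apply: contraTneq lo => ->; rewrite mul0r -ltNge mulr_gt0.
apply: le_trans (alpha_deletion_tail F hp p0) _.
rewrite (_ : 2 / L = L^-1 + L^-1); last by ring.
apply: lerD; first by apply: exp_neg_le_invL; lra.
(* [z] is [p] relative to the upper end of the range; the Markov term becomes
   [4 * z ^+ 2 / L ^+ 12]. *)
set z := p * Y ^+ 3 * L ^+ 6 in hi.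
have z0 : 0 <= z by rewrite !mulr_ge0 ?exprn_ge0 // ltW //; move: Y_ge; lra.
have -> : p ^+ 2 * q%:R ^+ 3 = z ^+ 2 / L ^+ 12.
  by rewrite /z sqrY; field; rewrite gt_eqF.
apply: (@le_trans _ _ (4 / L ^+ 12)).
  by rewrite mulrA ler_pM2r ?invr_gt0 ?exprn_gt0 //; nra.
rewrite ler_pdivrMr ?exprn_gt0 // exprS mulKf ?gt_eqF //.
apply: (@le_trans _ _ L); first by move: L_large; lra.
by rewrite ler_eXnr // ; move: L_large; lra.
Qed.

Lemma regime1 (p : R) : 0 <= p <= 1 ->
  L ^+ 6 <= p * q%:R ^+ 2 -> p * Y ^+ 3 * L ^+ 6 <= 1 ->
  1 - 3 / L <= prob_random_set p (fun S : {set 'rV[F]_2} =>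
    1 / 4 * (p * q%:R ^+ 2) <= (alpha S)%:R <= 3 * (p * q%:R ^+ 2)).
Proof.
move=> hp lo hi; rewrite probC lerD2l lerN2.
have L6 : 16 * L <= L ^+ 6.
  rewrite exprSr ler_pM2r //; apply: (@le_trans _ _ L); first by move: L_large; lra.
  by rewrite ler_eXnr //; move: L_large; lra.
apply: le_trans (prob_mono hp (E' := fun S =>
    ~~ (1 / 4 * (p * q%:R ^+ 2) <= (alpha S)%:R) ||
    (3 * (p * q%:R ^+ 2) <= (alpha S)%:R)) _) _.
  by move=> S; rewrite negb_and => /orP[->//|]; rewrite -ltNge => /ltW ->; rewrite orbT.
apply: le_trans (probU_le _ _ hp) _.
rewrite (_ : 3 / L = 2 / L + L^-1); last by ring.
apply: lerD; first by apply: deletion_regime => //; apply: le_trans lo.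
apply: le_trans (alpha_upper_tail F hp) _; apply: exp_neg_le_invL; move: L_gt0; lra.
Qed.

Lemma regime2 (p : R) : 0 <= p <= 1 ->
  1 <= p * Y ^+ 3 * L ^+ 6 -> p * Y <= L ^+ 6 ->
  1 - 3 / L <= prob_random_set p (fun S : {set 'rV[F]_2} =>
    Y / L ^+ 8 <= (alpha S)%:R <= Y * L ^+ 8).
Proof.
move=> hp lo hi; rewrite probC lerD2l lerN2.
have Y0 : 0 < Y by move: Y_ge; lra.
apply: le_trans (prob_mono hp (E' := fun S =>
    ~~ (Y / L ^+ 8 <= (alpha S)%:R) || (Y * L ^+ 8 <= (alpha S)%:R)) _) _.
  by move=> S; rewrite negb_and => /orP[->//|]; rewrite -ltNge => /ltW ->; rewrite orbT.
apply: le_trans (probU_le _ _ hp) _.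
rewrite (_ : 3 / L = 2 / L + L^-1); last by ring.
apply: lerD.
  (* The largest density that [deletion_regime] allows. The lower bound obtained there carries over
     to [p], since [alpha] is monotone in the set. *)
  pose p0 := (Y ^+ 3 * L ^+ 6)^-1.
  have d0 : 0 < Y ^+ 3 * L ^+ 6 by rewrite mulr_gt0 ?exprn_gt0.
  have p0_gt0 : 0 < p0 by rewrite invr_gt0.
  have p0p : p0 <= p by rewrite -[p0]mul1r ler_pdivrMr // mulrA.
  have p01 : 0 <= p0 <= 1 by case/andP: hp => _ p1; rewrite ltW //= (le_trans p0p).
  have p0q : p0 * q%:R ^+ 2 = Y / L ^+ 6.
    by rewrite /p0 sqrY; field; rewrite !gt_eqF.
  apply: (@le_trans _ _ (prob_random_set p0 (fun S : {set 'rV[F]_2} =>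
    ~~ (Y / L ^+ 8 <= (alpha S)%:R)))).
    rewrite -[leLHS]opprK -[leRHS]opprK lerN2 -(lerD2l 1) -!probC.
    apply: prob_increasing => //; try by [case/andP: p01|case/andP: hp].
    by move=> S S' SS' h; apply: le_trans h _; rewrite ler_nat alpha_mono.
  apply: le_trans (deletion_regime p01 _ _).
  - apply: prob_mono => // S; apply: contraNN; apply: le_trans.
    rewrite p0q ler_pdivrMr ?exprn_gt0 //.
    rewrite (_ : _ * L ^+ 8 = Y * (L ^+ 2 / 4)).
      by rewrite ler_peMr ?ltW //; move: L_large; nra.
    by field; rewrite gt_eqF.
  - rewrite p0q ler_pdivlMr ?exprn_gt0 //; apply: le_trans LY.
    rewrite -mulrA -exprS [leRHS](exprD _ 7 2) mulrC.
    by rewrite ler_wpM2l ?exprn_ge0 ?ltW //; move: L_large; nra.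
  - by rewrite -mulrA mulVf // gt_eqF.
have h8 : 2 * Y <= Y * L ^+ 8.
  rewrite mulrC ler_pM2l //; apply: (@le_trans _ _ L); first by move: L_large; lra.
  by rewrite ler_eXnr //; move: L_large; lra.
have hl : 0 < (1 / 4 : R) <= 1 / 4 by apply/andP; split; lra.
apply: le_trans (arc_tail hp hl h8) _.
rewrite -[X in expR X]opprK; apply: exp_neg_le_invL.
have pq : p * ((1 + 2 / L) * q%:R) <= 2 * (Y * L ^+ 6).
  have -> : p * ((1 + 2 / L) * q%:R) = (1 + 2 / L) * (Y * (p * Y)) by rewrite sqrY; ring.
  apply: ler_pM.
  - by rewrite addr_ge0 // divr_ge0 // ltW.
  - by case/andP: hp => hp0 _; rewrite !mulr_ge0 // ltW.
  - rewrite -lerBrDl ler_pdivrMr //; move: L_large; lra.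
  - by rewrite ler_pM2l.
have L3 : 212 ^+ 2 <= L ^+ 2 by apply: lerXn2r; rewrite ?nnegrE //; move: L_large; lra.
apply: (@le_trans _ _ Y); first exact: L_le_Y.
have L36 : L ^+ 3 <= L ^+ 6 by rewrite ler_weXn2l //; move: L_large; lra.
have L16 : 1 <= L ^+ 6 by rewrite expr_ge1 //; move: L_large; lra.
(* The saving [lam * m = Y * L ^+ 8 / 4] beats the entropy and the mean term, which is at most
   [Y * L ^+ 6], with [Y] to spare. *)
have : 1 + 105 * L ^+ 3 + L ^+ 6 <= L ^+ 8 / 4.
  by rewrite (exprD _ 6 2); nra.
move=> hh; have : Y * (1 + 105 * L ^+ 3 + L ^+ 6) <= Y * (L ^+ 8 / 4) by rewrite ler_pM2l.
move: pq; set W := p * _; move: (L ^+ 3) (L ^+ 6) (L ^+ 8) L16 => a b c b1.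
nra.
Qed.

Lemma regime3 (p : R) : 0 <= p <= 1 -> L ^+ 6 <= p * Y ->
  1 - 3 / L <= prob_random_set p (fun S : {set 'rV[F]_2} =>
    (1 - 4 / L) * (p * q%:R) <= (alpha S)%:R <= (1 + 4 / L) * (p * q%:R)).
Proof.
move=> hp lo; rewrite probC lerD2l lerN2.
have Y0 : 0 < Y by move: Y_ge; lra.
have Linv : 0 < L^-1 by rewrite invr_gt0.
have L4inv : L^-1 <= 1 / 4.
  by rewrite -(ler_pM2r L_gt0) mulVf ?gt_eqF //; move: L_large; lra.
have pqE : p * q%:R = (p * Y) * Y by rewrite sqrY; ring.
have pq : L ^+ 6 * Y <= p * q%:R by rewrite pqE ler_pM2r.
have L6 : 2 <= L ^+ 6.
  apply: (@le_trans _ _ L); first by move: L_large; lra.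
  by rewrite ler_eXnr //; move: L_large; lra.
apply: le_trans (prob_mono hp (E' := fun S =>
    ~~ ((1 - 4 / L) * (p * q%:R) <= (alpha S)%:R) ||
    ((1 + 4 / L) * (p * q%:R) <= (alpha S)%:R)) _) _.
  by move=> S; rewrite negb_and => /orP[->//|]; rewrite -ltNge => /ltW ->; rewrite orbT.
apply: le_trans (probU_le _ _ hp) _.
apply: (@le_trans _ _ (L^-1 + L^-1)); last by lra.
apply: lerD.
  (* With [eta = 2 / L] the exponent is still at least [4 * L ^+ 4 * Y], because [p * q] is at least
     [L ^+ 6 * Y]. *)
  have eta0 : 0 < 2 / L by rewrite divr_gt0.
  have := alpha_parabola_tail F hp eta0.
  rewrite (_ : 2 * (2 / L) = 4 / L); last by ring.
  move=> h; apply: le_trans h _; apply: exp_neg_le_invL.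
  apply: (@le_trans _ _ (L ^+ 6 * Y * (2 / L) ^+ 2)); last first.
    by rewrite ler_pM2r // exprn_gt0.
  have -> : L ^+ 6 * Y * (2 / L) ^+ 2 = L * (4 * L ^+ 3 * Y).
    by field; rewrite gt_eqF.
  rewrite ler_peMr ?ltW //.
  have : 1 <= L ^+ 3 by rewrite expr_ge1 //; move: L_large; lra.
  by move: Y_ge; nra.
have hl : 0 < L^-1 <= 1 / 4 by rewrite Linv.
set P := p * q%:R in pq *.
have P0 : 0 <= P by rewrite (le_trans _ pq) // mulr_ge0 ?ltW //; lra.
have hm : 2 * Y <= (1 + 4 / L) * P.
  apply: (@le_trans _ _ P); last by rewrite ler_peMl // lerDl divr_ge0 // ltW.
  by apply: le_trans pq; rewrite ler_pM2r.
apply: le_trans (arc_tail hp hl hm) _.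
rewrite -[X in expR X]opprK; apply: exp_neg_le_invL.
apply: (@le_trans _ _ Y); first exact: L_le_Y.
have -> : p * ((1 + 2 / L) * q%:R) = P * (1 + 2 * L^-1) by rewrite /P; ring.
(* For [lam = L^-1] the terms of order [P / L] cancel, and the mean term minus [lam * m] is
   [- P * (L^-1 ^+ 2 - 2 * L^-1 ^+ 3)]. *)
have hP : P * (L^-1 ^+ 2 / 2) <= P * (L^-1 ^+ 2 - 2 * L^-1 ^+ 3).
  by rewrite ler_wpM2l //; move: L4inv; rewrite [_ ^+ 3]exprS; nra.
have hP2 : Y * (L ^+ 4 / 2) <= P * (L^-1 ^+ 2 / 2).
  apply: (@le_trans _ _ (L ^+ 6 * Y * (L^-1 ^+ 2 / 2))).
    by rewrite le_eqVlt; apply/orP; left; apply/eqP; field; rewrite gt_eqF.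
  by rewrite ler_wpM2r // divr_ge0 // exprn_ge0 // ltW.
have hL : 1 + 105 * L ^+ 3 <= L ^+ 4 / 2.
  have : 1 <= L ^+ 3 by rewrite expr_ge1 //; move: L_large; lra.
  by rewrite [L ^+ 4]exprS; move: L_large; nra.
have : Y * (1 + 105 * L ^+ 3) <= Y * (L ^+ 4 / 2) by rewrite ler_pM2l.
lra.
Qed.

End LargeField.

(** * Passage to the limit in [q] *)

Section Asymptotics.
Variable R : realType.

Lemma near_ln_ge (M : R) : \forall q \near \oo%classic, M <= ln (q%:R : R).
Proof.
apply: filterS (nbhs_infty_ger (expR M)) => q hq.
by rewrite -ler_expR lnK // posrE (lt_le_trans (expR_gt0 M)).
Qed.

Lemma inv_ln_cvg0 (c : R) :
  (c / ln (q%:R : R) @[q --> \oo] --> (0 : R))%classic.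
Proof.
apply/cvgr0Pnorm_le => e e0; have c1 : 0 < `|c| + 1 by rewrite ltr_wpDl.
apply: filterS (near_ln_ge ((`|c| + 1) / e)) => q hq.
have L0 : 0 < ln (q%:R : R) by apply: lt_le_trans hq; rewrite divr_gt0.
rewrite normrM normfV (gtr0_norm L0) ler_pdivrMr // mulrC -ler_pdivrMr //.
by apply: le_trans hq; rewrite ler_pM2r ?invr_gt0 // lerDl.
Qed.

Lemma qpolylogE (a : R) (q n : nat) : (0 < q)%N -> 0 <= ln (q%:R : R) ->
  qpolylog a n%:R q = expR (a * ln q%:R) * ln (q%:R : R) ^+ n.
Proof.
move=> q0 L0; rewrite /qpolylog powR_mulrn // {1}/powR gt_eqF ?ltr0n //.
Qed.

Lemma qpolylogNE (a : R) (q n : nat) : (0 < q)%N -> 0 <= ln (q%:R : R) ->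
  qpolylog a (- n%:R) q = expR (a * ln q%:R) / ln (q%:R : R) ^+ n.
Proof.
move=> q0 L0; rewrite /qpolylog powRN powR_mulrn // {1}/powR gt_eqF ?ltr0n //.
Qed.

(** The term of degree 10 in the exponential series of [x / 2] alone suffices. *)
Lemma expR_half_large (x : R) : 2 ^+ 10 * 10`!%:R <= x -> x ^+ 9 <= expR (x / 2).
Proof.
move=> hx; have c0 : 0 < 2 ^+ 10 * 10`!%:R :> R by rewrite mulr_gt0 ?exprn_gt0 ?ltr0n ?fact_gt0.
have x0 : 0 < x by apply: lt_le_trans hx.
have x2 : 0 <= x / 2 by rewrite divr_ge0 // ltW.
apply: (@le_trans _ _ ((x / 2) ^+ 10 / 10`!%:R)); last first.
  by apply: le_trans (expR_ge1Dxn 9 x2); rewrite lerDr.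
rewrite expr_div_n -mulrA -invfM ler_pdivlMr // [x ^+ 10]exprSr.
by rewrite ler_pM2l ?exprn_gt0.
Qed.

(** The three entries ensure, in order, [L ^+ 9 <= Y], [212 <= L] and an error probability [3 / L]
    of at most [eps]. *)
Definition threshold (eps : R) : R :=
  Num.max (2 ^+ 10 * 10`!%:R) (Num.max 212 (3 / eps)).

Lemma threshold_spec (eps : R) (q : nat) (L := ln (q%:R : R)) (Y := expR (L / 2)) :
  0 < eps -> (0 < q)%N -> threshold eps <= L ->
  [/\ 212 <= L, L ^+ 9 <= Y, q%:R = expR L, q%:R = Y ^+ 2 & 3 / L <= eps].
Proof.
move=> e0 q0; rewrite /threshold !ge_max => /and3P[h1 h2 h3].
have qL : q%:R = expR L by rewrite lnK // posrE ltr0n.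
split => //; first exact: expR_half_large.
  by rewrite qL -expRM_natl; congr expR; field.
have L0 : 0 < L by lra.
by rewrite ler_pdivrMr // mulrC -ler_pdivrMr.
Qed.

End Asymptotics.

Theorem theorem4 (R : realType) :
  exists (c1 c2 A B : R) (e : nat -> R),
    [/\ 0 < c1, 0 < c2, 0 < A, 0 < B & (e q @[q --> \oo] --> (0 : R))%classic] /\
    forall p : nat -> R,
      (forall q : nat, prime_power q -> 0 <= p q <= 1) ->
      [/\ eventually_between (qpolylog (- 2) A) p
                             (qpolylog (- (3 / 2)) (- A)) ->
          with_high_probability p (fun F S =>
            c1 * (p #|F| * #|F|%:R ^+ 2) <= (alpha S)%:R
              <= c2 * (p #|F| * #|F|%:R ^+ 2)),
          eventually_between (qpolylog (- (3 / 2)) (- A)) p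
                             (qpolylog (- (1 / 2)) A) ->
          with_high_probability p (fun F S =>
            qpolylog (1 / 2) (- B) #|F| <= (alpha S)%:R
              <= qpolylog (1 / 2) B #|F|) &
          eventually_between (qpolylog (- (1 / 2)) A) p (fun=> 1) ->
          with_high_probability p (fun F S =>
            (1 - e #|F|) * (p #|F| * #|F|%:R) <= (alpha S)%:R
              <= (1 + e #|F|) * (p #|F| * #|F|%:R))].
Proof.
(* The constants [1 / 4] and [3] come from [regime1], [A = 6] is the power of [L] bounding all three
   ranges, [B = 8] comes from [regime2], and the error [4 / L] from [regime3]. *)
exists (1 / 4), 3, 6, 8, (fun q => 4 / ln (q%:R : R)).
split; first by split; rewrite ?divr_gt0 //; exact: inv_ln_cvg0.
move=> p p01.
have q_gt0 (F : finFieldType) : (0 < #|F|)%N by apply/card_gt0P; exists 0.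
have e2 (L : R) : expR (- 2 * L) = (expR (L / 2) ^+ 4)^-1.
  by rewrite -expRM_natl -expRN; congr expR; field.
have e32 (L : R) : expR (- (3 / 2) * L) = (expR (L / 2) ^+ 3)^-1.
  by rewrite -expRM_natl -expRN; congr expR; field.
have e12 (L : R) : expR (- (1 / 2) * L) = (expR (L / 2))^-1.
  by rewrite -expRN; congr expR; field.
have e12' (L : R) : expR (1 / 2 * L) = expR (L / 2) by congr expR; field.
split=> H eps eps0; apply: filterS2 H (near_ln_ge (threshold eps)) => q + Lq F cF;
  subst q; move/(_ (prime_power_card F)) => /andP[lo hi];
  have [L212 LY qL qY Leps] := threshold_spec eps0 (q_gt0 F) Lq;
  have L0 : 0 <= ln (#|F|%:R : R) by [lra];
  have {}p01 := p01 _ (prime_power_card F);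
  set L := ln _ in L212 LY qL qY Leps L0 lo hi *;
  have Lgt0 : 0 < L by [lra];
  set Y := expR (L / 2) in LY qY;
  have Y0 : 0 < Y by [exact: expR_gt0];
  have := lo; have := hi;
  rewrite ?(qpolylogE _ _ (q_gt0 F) L0) ?(qpolylogNE _ _ (q_gt0 F) L0)
    ?e2 ?e32 ?e12 ?e12' -/L -/Y => {}hi {}lo;
  (apply: (@le_trans _ _ (1 - 3 / L)); first by rewrite lerD2l lerN2).
- apply: (regime1 qY L212 LY p01).
  + rewrite qY -exprM; move: lo; rewrite mulrC ler_pdivrMr ?exprn_gt0 //.
  + move: hi; rewrite -invfM -[X in _ <= X]mul1r ler_pdivlMr ?mulr_gt0 ?exprn_gt0 //.
    by rewrite mulrA.
- have := regime2 qL qY L212 LY p01; apply.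
  + move: lo; rewrite -invfM -[X in X <= _]mul1r ler_pdivrMr ?mulr_gt0 ?exprn_gt0 //.
    by rewrite mulrA.
  + by move: hi; rewrite mulrC ler_pdivlMr.
- apply: (regime3 qL qY L212 LY p01).
  by move: lo; rewrite mulrC ler_pdivrMr.
Qed.
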